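(* Let $K$ be a finite field and let $R$ be a finite dimensional $K$-algebra. Then the rank spectrum $\mathrm{Rank}(R)$ is a convex, compact subspace of $\mathrm{Syl}(R)$.
   Context: For a ring $S$, $\mathrm{Mat}(S)$ denotes the set of all finite rectangular matrices over $S$. A Sylvester rank function on $S$ is a function $\mathrm{rk}:\mathrm{Mat}(S)\to[0,\infty)$ with $\mathrm{rk}(1)=1$ for the $1\times1$ identity matrix, $\mathrm{rk}\begin{pmatrix}A&0\\0&B\end{pmatrix}=\mathrm{rk}(A)+\mathrm{rk}(B)$, $\mathrm{rk}\begin{pmatrix}A&0\\C&B\end{pmatrix}\ge\mathrm{rk}(A)+\mathrm{rk}(B)$, and $\mathrm{rk}(AB)\le\min(\mathrm{rk}(A),\mathrm{rk}(B))$, for matrices of appropriate sizes. $\mathrm{Syl}(R)$ is the set of all Sylvester rank functions on $R$, a convex compact subset of $\mathbb{R}^{\mathrm{Mat}(R)}$ with the topology of pointwise convergence. A rank algebra is a $K$-algebra $S$ which is a von Neumann regular ring and is equipped with a Sylvester rank function $\mathrm{rank}_S$ on $\mathrm{Mat}(S)$ such that $\mathrm{rank}_S(A)=0$ implies $A=0$. For a representation (unital $K$-algebra homomorphism) $\rho:R\to S$ into a rank algebra, $\mathrm{rk}_\rho(A)=\mathrm{rank}_S(\tilde\rho(A))$ for $A\in\mathrm{Mat}(R)$, where $\tilde\rho$ is $\rho$ applied entrywise. $\mathrm{Rank}(R)$ is the set of all elements of $\mathrm{Syl}(R)$ of the form $\mathrm{rk}_\rho$ for some representation $\rho$ of $R$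 into a rank algebra. *)

(* Defs.v *)
From HB Require Import structures.
From mathcomp Require Import all_boot all_order all_algebra all_field.
From mathcomp Require Import all_classical all_reals all_analysis.

Set Implicit Arguments.
Unset Strict Implicit.
Unset Printing Implicit Defensive.

Import Order.TTheory GRing.Theory Num.Theory.
Import numFieldNormedType.Exports.

Local Open Scope classical_set_scope.
Local Open Scope ring_scope.

Definition Mat (S : Type) : Type := {d : nat * nat & 'M[S]_(d.1, d.2)}.

Definition mat (S : Type) (m n : nat) (A : 'M[S]_(m, n)) : Mat S :=
  existT (fun d : nat * nat => 'M[S]_(d.1, d.2)) (m, n) A.

(* Matrices with no row or no column belong to [Mat S].  This is harmless: the
   axioms force [rk] to vanish on them ([rk] of the 0 x 0 matrix is 0 by
   additivity, and every empty matrix factors through it), and a rank function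
   given on nonempty matrices only extends by 0. *)
Record sylvester_rank_function (F : realType) (S : pzRingType)
    (rk : Mat S -> F) : Prop := SylvesterRankFunction {
  syl_ge0 : forall A : Mat S, 0 <= rk A;
  syl1 : rk (mat (1%:M : 'M[S]_1)) = 1;
  syl_diag : forall (m n p q : nat) (A : 'M[S]_(m, n)) (B : 'M[S]_(p, q)),
    rk (mat (block_mx A 0 0 B)) = rk (mat A) + rk (mat B);
  syl_trig : forall (m n p q : nat) (A : 'M[S]_(m, n)) (B : 'M[S]_(p, q))
      (C : 'M[S]_(p, n)),
    rk (mat A) + rk (mat B) <= rk (mat (block_mx A 0 C B));
  syl_mul : forall (m n p : nat) (A : 'M[S]_(m, n)) (B : 'M[S]_(n, p)),
    rk (mat (A *m B)) <= Num.min (rk (mat A)) (rk (mat B))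
}.

Definition von_neumann_regular (S : pzRingType) : Prop :=
  forall a : S, exists x : S, a = a * x * a.

Record rank_algebra (F : realType) (K : fieldType) : Type := RankAlgebra {
  rank_algebra_sort :> algType K;
  rank_algebra_regular : von_neumann_regular rank_algebra_sort;
  rank_of : Mat rank_algebra_sort -> F;
  rank_of_sylvester : sylvester_rank_function rank_of;
  rank_of_faithful : forall (m n : nat) (A : 'M[rank_algebra_sort]_(m, n)),
    rank_of (mat A) = 0 -> A = 0
}.

Definition rk_rep (F : realType) (K : fieldType) (R : algType K)
    (S : rank_algebra F K) (rho : {lrmorphism R -> S}) (A : Mat R) : F :=
  rank_of (mat (map_mx rho (projT2 A))).

(* [{ptws _ -> _}] carries the topology of pointwise convergence; its vector
   space structure over [F] is the pointwise one. *)
Definition Syl (F : realType) (R : pzRingType) : set {ptws Mat R -> F^o} :=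
  [set rk | sylvester_rank_function rk].

Definition Rank (F : realType) (K : fieldType) (R : algType K) :
    set {ptws Mat R -> F^o} :=
  [set rk | Syl rk /\
    exists (S : rank_algebra F K) (rho : {lrmorphism R -> S}), rk = rk_rep rho].

Arguments Syl : clear implicits.
Arguments Rank : clear implicits.

(* Main.v *)
(* If S is a von Neumann regular algebra with a Sylvester rank function, not
   necessarily faithful, then the elements of rank 0 form a two-sided ideal,
   and the rank descends to a faithful one on the (still regular) quotient.
   Given rank algebras S_i and a mean L on bounded functions of i, the product
   of the S_i is regular and A |-> L (i |-> rank (A_i)) is a Sylvester rank
   function on it.  Hence Rank(R) is closed under means.  Weighted averages over
   two indices give convexity; limits along an ultrafilter on Rank(R), i.e.
   ultraproducts, give compactness. *)

Require Import Defs.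
From HB Require Import structures.
From mathcomp Require Import all_boot all_order all_algebra all_field.
From mathcomp Require Import all_classical all_reals all_analysis.
Import numFieldNormedType.Exports.
Import Order.TTheory GRing.Theory Num.Theory.
Set Implicit Arguments.
Unset Strict Implicit.
Unset Printing Implicit Defensive.
Local Open Scope classical_set_scope.
Local Open Scope ring_scope.

(** * Elementary consequences of the Sylvester axioms *)

Section SylvesterTheory.
Variables (F : realType) (S : pzRingType) (rk : Mat S -> F).
Hypothesis rkP : sylvester_rank_function rk.
Implicit Types m n p : nat.

Lemma syl_mull m n p (A : 'M[S]_(m, n)) (B : 'M[S]_(n, p)) :
  rk (mat (A *m B)) <= rk (mat A).
Proof. by have := syl_mul rkP A B; rewrite le_min => /andP[]. Qed.

Lemma syl_mulr m n p (A : 'M[S]_(m, n)) (B : 'M[S]_(n, p)) :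
  rk (mat (A *m B)) <= rk (mat B).
Proof. by have := syl_mul rkP A B; rewrite le_min => /andP[]. Qed.

Lemma syl0 m n : rk (mat (0 : 'M[S]_(m, n))) = 0.
Proof.
have rk00 : rk (mat (0 : 'M[S]_(0, 0))) = 0.
  have := syl_diag rkP (0 : 'M[S]_(0, 0)) (0 : 'M[S]_(0, 0)).
  have -> : block_mx (0 : 'M[S]_0) 0 0 (0 : 'M[S]_0) = 0 :> 'M[S]_0.
    exact: flatmx0.
  move/eqP.
  by rewrite -[X in X == _]addr0 (inj_eq (addrI _)) => /eqP.
apply/eqP; rewrite eq_le (syl_ge0 rkP) andbT -[leRHS]rk00.
have -> : (0 : 'M[S]_(m, n)) =
    (0 : 'M[S]_(m, 0)) *m (0 : 'M[S]_(0, 0)) *m (0 : 'M[S]_(0, n)).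
  by rewrite mulmx0.
exact: le_trans (syl_mull _ _) (syl_mulr _ _).
Qed.

Lemma syl_scalar1 n : rk (mat (1%:M : 'M[S]_n)) = n%:R.
Proof.
elim: n => [|n IHn]; first by rewrite flatmx0 syl0.
have := syl_diag rkP (1%:M : 'M[S]_1) (1%:M : 'M[S]_n).
by rewrite -scalar_mx_block IHn (syl1 rkP) -natr1 addrC.
Qed.

(** Multiplying by the identity on the left bounds the rank by that of the identity. Families of
    ranks are bounded in this way when means are applied to them. *)
Lemma syl_le_row m n (A : 'M[S]_(m, n)) : rk (mat A) <= m%:R.
Proof. by rewrite -[A]mul1mx -syl_scalar1; exact: syl_mull. Qed.

(** The sum factors through the block diagonal matrix of [A] and [B], between a row and a column of
    identity blocks. *)
Lemma sylD m n (A B : 'M[S]_(m, n)) :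
  rk (mat (A + B)) <= rk (mat A) + rk (mat B).
Proof.
have -> : A + B = row_mx 1%:M 1%:M *m block_mx A 0 0 B *m col_mx 1%:M 1%:M.
  by rewrite mul_row_block mul_row_col !mulmx0 !mul1mx !mulmx1 addr0 add0r.
by rewrite -(syl_diag rkP); exact: le_trans (syl_mull _ _) (syl_mulr _ _).
Qed.

Lemma sylN m n (A : 'M[S]_(m, n)) : rk (mat (- A)) = rk (mat A).
Proof.
have le_rkN (B : 'M[S]_(m, n)) : rk (mat (- B)) <= rk (mat B).
  by rewrite -[B]mul1mx -mulNmx mul1mx; exact: syl_mulr.
by apply/eqP; rewrite eq_le le_rkN -{1}[A]opprK le_rkN.
Qed.

(** An entry is cut out by a unit row on the left and a unit column on the right. *)
Lemma syl_entry m n (A : 'M[S]_(m, n)) i j :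
  rk (mat ((A i j)%:M : 'M[S]_1)) <= rk (mat A).
Proof.
have -> : ((A i j)%:M : 'M[S]_1) = delta_mx 0 i *m A *m delta_mx j 0.
  by apply/matrixP => k l; rewrite -rowE -colE !mxE !ord1.
exact: le_trans (syl_mull _ _) (syl_mulr _ _).
Qed.

(** Each term of the expansion in matrix units factors through a 1 x 1 matrix of rank 0, and rank is
    subadditive. With [syl_entry], having rank 0 becomes a condition on the entries alone. *)
Lemma syl_eq0 m n (A : 'M[S]_(m, n)) :
  (forall i j, rk (mat ((A i j)%:M : 'M[S]_1)) = 0) -> rk (mat A) = 0.
Proof.
move=> A0; apply/eqP; rewrite eq_le (syl_ge0 rkP) andbT.
rewrite [A]matrix_sum_delta.
have rk_sum (I : Type) (r : seq I) (B : I -> 'M[S]_(m, n)) :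
    (forall i, rk (mat (B i)) <= 0) -> rk (mat (\sum_(i <- r) B i)) <= 0.
  move=> B0; elim/big_ind: _ => [|C D C0 D0|//]; first by rewrite syl0.
  by apply: le_trans (sylD _ _) _; rewrite -[leRHS]addr0 lerD.
apply: (rk_sum) => i; apply: (rk_sum) => j; rewrite -(A0 i j).
have -> : A i j *: delta_mx i j =
    delta_mx i 0 *m ((A i j)%:M : 'M[S]_1) *m delta_mx 0 j :> 'M[S]_(m, n).
  apply/matrixP => k l; rewrite !mxE big_ord1 !mxE big_ord1 !mxE !eqxx andbT /=.
  by case: (k == i); case: (l == j); rewrite ?(mulr0, mul0r, mulr1, mul1r).
exact: le_trans (syl_mull _ _) (syl_mulr _ _).
Qed.

(** This lets the rank descend to the quotient by the elements of rank 0. *)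
Lemma syl_congr m n (A B : 'M[S]_(m, n)) :
  rk (mat (A - B)) = 0 -> rk (mat A) = rk (mat B).
Proof.
move=> AB0; apply/eqP; rewrite eq_le; apply/andP; split.
  by rewrite -[A](subrK B) (le_trans (sylD _ _))// AB0 add0r.
rewrite -[B](subrK A) (le_trans (sylD _ _))//.
by rewrite -opprB sylN AB0 add0r.
Qed.

End SylvesterTheory.

(** * The quotient by the elements of rank 0 *)

Section RankQuotient.
Variables (F : realType) (K : fieldType) (S : algType K) (rk : Mat S -> F).

(** The proof of the axioms is an argument so that the closure instance below, which depends on it,
    can be inferred from the predicate. *)
Definition rank_kernel of sylvester_rank_function rk : pred S :=
  fun a => rk (mat (a%:M : 'M[S]_1)) == 0.

Hypothesis rkP : sylvester_rank_function rk.
Local Notation I := (rank_kernel rkP).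

Lemma rank_kernel_zmod_closed : zmod_closed I.
Proof.
split.
  by rewrite unfold_in /= /rank_kernel (raddf0 (@scalar_mx S 1)) syl0.
move=> a b; rewrite !unfold_in /= /rank_kernel => /eqP a0 /eqP b0.
rewrite eq_le (syl_ge0 rkP) andbT raddfB/= (le_trans (sylD rkP _ _))//.
by rewrite sylN// a0 b0 addr0.
Qed.

HB.instance Definition _ :=
  GRing.isZmodClosed.Build S I rank_kernel_zmod_closed.

Lemma rank_kernelMl a b : b \in I -> a * b \in I.
Proof.
rewrite !unfold_in /= /rank_kernel => /eqP b0.
by rewrite eq_le (syl_ge0 rkP) andbT scalar_mxM -b0 syl_mulr.
Qed.

Lemma rank_kernelMr a b : a \in I -> a * b \in I.
Proof.
rewrite !unfold_in /= /rank_kernel => /eqP a0.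
by rewrite eq_le (syl_ge0 rkP) andbT scalar_mxM -a0 syl_mull.
Qed.

(** Only the additive group is divided here. Products and scaling go through representatives;
    [rank_quotient_mulE] and [rank_quotient_scaleE] show that the choice does not matter. *)
Definition rank_quotient := Quotient.quot (GRing.ZmodClosed.clone S I _).
HB.instance Definition _ := GRing.Zmodule.on rank_quotient.

Definition rank_pi (a : S) : rank_quotient := (\pi_rank_quotient a)%qT.
Definition rank_repr (x : rank_quotient) : S := repr x.

Lemma rank_reprK : cancel rank_repr rank_pi.
Proof. exact: reprK. Qed.

Lemma rank_piP a b : reflect (rank_pi a = rank_pi b) (a - b \in I).
Proof. by rewrite Quotient.idealrBE; exact: eqP. Qed.

Lemma rank_pi_zmod_morphism : zmod_morphism rank_pi.
Proof. by move=> a b; rewrite /rank_pi !piE. Qed.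

HB.instance Definition _ :=
  GRing.isZmodMorphism.Build S rank_quotient rank_pi rank_pi_zmod_morphism.

(** Reduces each algebra law on the quotient to the same law in [S]. *)
Lemma rank_quotient_ind (P : rank_quotient -> Prop) :
  (forall a, P (rank_pi a)) -> forall x, P x.
Proof. by move=> Ppi x; rewrite -[x]rank_reprK. Qed.

Lemma rank_repr_pi a : a - rank_repr (rank_pi a) \in I.
Proof. by apply/rank_piP; rewrite rank_reprK. Qed.

Definition rank_quotient_one := rank_pi 1.
Definition rank_quotient_mul x y := rank_pi (rank_repr x * rank_repr y).
Definition rank_quotient_scale (k : K) x := rank_pi (k *: rank_repr x).

Lemma rank_quotient_mulE a b :
  rank_quotient_mul (rank_pi a) (rank_pi b) = rank_pi (a * b).
Proof.
apply/esym/rank_piP; set a' := rank_repr _; set b' := rank_repr _.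
(* Changing one factor at a time leaves one term for left and one for right absorption by the
   kernel. *)
have -> : a * b - a' * b' = a * (b - b') + (a - a') * b'.
  by rewrite mulrBr mulrBl addrA subrK.
by apply: rpredD; [apply: rank_kernelMl|apply: rank_kernelMr];
  exact: rank_repr_pi.
Qed.

Lemma rank_quotient_scaleE k a :
  rank_quotient_scale k (rank_pi a) = rank_pi (k *: a).
Proof.
apply/esym/rank_piP; rewrite -scalerBr -mulr_algl.
by apply: rank_kernelMl; exact: rank_repr_pi.
Qed.

Lemma rank_quotient_mulA : associative rank_quotient_mul.
Proof.
elim/rank_quotient_ind=> a; elim/rank_quotient_ind=> b.
by elim/rank_quotient_ind=> c; rewrite !rank_quotient_mulE mulrA.
Qed.

Lemma rank_quotient_mul1 : left_id rank_quotient_one rank_quotient_mul.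
Proof. by elim/rank_quotient_ind=> a; rewrite rank_quotient_mulE mul1r. Qed.

Lemma rank_quotient_mulr1 : right_id rank_quotient_one rank_quotient_mul.
Proof. by elim/rank_quotient_ind=> a; rewrite rank_quotient_mulE mulr1. Qed.

Lemma rank_quotient_mulDl : left_distributive rank_quotient_mul +%R.
Proof.
elim/rank_quotient_ind=> a; elim/rank_quotient_ind=> b.
elim/rank_quotient_ind=> c.
by rewrite -raddfD !rank_quotient_mulE mulrDl raddfD.
Qed.

Lemma rank_quotient_mulDr : right_distributive rank_quotient_mul +%R.
Proof.
elim/rank_quotient_ind=> a; elim/rank_quotient_ind=> b.
elim/rank_quotient_ind=> c.
by rewrite -raddfD !rank_quotient_mulE mulrDr raddfD.
Qed.

Lemma rank_quotient_one_neq0 : rank_quotient_one != 0.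
Proof.
apply/eqP; rewrite -(raddf0 rank_pi) => /rank_piP; rewrite subr0.
by rewrite unfold_in /= /rank_kernel (syl1 rkP) oner_eq0.
Qed.

HB.instance Definition _ := GRing.Zmodule_isNzRing.Build rank_quotient
  rank_quotient_mulA rank_quotient_mul1 rank_quotient_mulr1
  rank_quotient_mulDl rank_quotient_mulDr rank_quotient_one_neq0.

Lemma rank_pi_monoid_morphism : monoid_morphism rank_pi.
Proof. by split=> // a b; rewrite -rank_quotient_mulE. Qed.

HB.instance Definition _ :=
  GRing.isMonoidMorphism.Build S rank_quotient rank_pi rank_pi_monoid_morphism.

Lemma rank_quotient_scaleA a b x : rank_quotient_scale a
  (rank_quotient_scale b x) = rank_quotient_scale (a * b) x.
Proof.
by elim/rank_quotient_ind: x => x; rewrite !rank_quotient_scaleE scalerA.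
Qed.

Lemma rank_quotient_scale1 : left_id 1 rank_quotient_scale.
Proof. by elim/rank_quotient_ind=> x; rewrite rank_quotient_scaleE scale1r. Qed.

Lemma rank_quotient_scaleDr : right_distributive rank_quotient_scale +%R.
Proof.
move=> k; elim/rank_quotient_ind=> x; elim/rank_quotient_ind=> y.
by rewrite -raddfD !rank_quotient_scaleE scalerDr raddfD.
Qed.

Lemma rank_quotient_scaleDl x :
  {morph rank_quotient_scale^~ x : a b / a + b}.
Proof.
elim/rank_quotient_ind: x => x a b.
by rewrite !rank_quotient_scaleE scalerDl raddfD.
Qed.

HB.instance Definition _ := GRing.Zmodule_isLmodule.Build K rank_quotient
  rank_quotient_scaleA rank_quotient_scale1
  rank_quotient_scaleDr rank_quotient_scaleDl.

Lemma rank_pi_scalable : scalable rank_pi.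
Proof. by move=> k a; rewrite -rank_quotient_scaleE. Qed.

HB.instance Definition _ :=
  GRing.isScalable.Build K S rank_quotient *:%R rank_pi rank_pi_scalable.

Lemma rank_quotient_scaleAl k (x y : rank_quotient) :
  k *: (x * y) = (k *: x) * y.
Proof.
elim/rank_quotient_ind: x => x; elim/rank_quotient_ind: y => y.
by rewrite -rmorphM -!linearZ/= -rmorphM scalerAl.
Qed.

HB.instance Definition _ :=
  GRing.Lmodule_isLalgebra.Build K rank_quotient rank_quotient_scaleAl.

Lemma rank_quotient_scaleAr k (x y : rank_quotient) :
  k *: (x * y) = x * (k *: y).
Proof.
elim/rank_quotient_ind: x => x; elim/rank_quotient_ind: y => y.
by rewrite -rmorphM -!linearZ/= -rmorphM scalerAr.
Qed.

HB.instance Definition _ :=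
  GRing.Lalgebra_isAlgebra.Build K rank_quotient rank_quotient_scaleAr.

Definition rank_quotient_rk (A : Mat rank_quotient) : F :=
  rk (mat (map_mx rank_repr (projT2 A))).

(** The entries of [A] differ from the chosen representatives by elements of the kernel, so any lift
    gives the same rank. *)
Lemma rank_quotient_rk_pi m n (A : 'M[S]_(m, n)) :
  rank_quotient_rk (mat (map_mx rank_pi A)) = rk (mat A).
Proof.
apply/esym/(syl_congr rkP)/(syl_eq0 rkP) => i j; rewrite !mxE.
by have /eqP := rank_repr_pi (A i j).
Qed.

Lemma map_rank_reprK m n (A : 'M[rank_quotient]_(m, n)) :
  map_mx rank_pi (map_mx rank_repr A) = A.
Proof. by apply/matrixP => i j; rewrite !mxE rank_reprK. Qed.

Lemma rank_quotient_sylvester : sylvester_rank_function rank_quotient_rk.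
Proof.
split.
- by move=> A; exact: (syl_ge0 rkP).
- by rewrite -(map_mx1 rank_pi) rank_quotient_rk_pi (syl1 rkP).
- move=> m n p q A B; rewrite -[A]map_rank_reprK -[B]map_rank_reprK.
  rewrite -(map_mx0 rank_pi) -(map_mx0 rank_pi) -map_block_mx.
  by rewrite !rank_quotient_rk_pi (syl_diag rkP).
- move=> m n p q A B C.
  rewrite -[A]map_rank_reprK -[B]map_rank_reprK -[C]map_rank_reprK.
  rewrite -(map_mx0 rank_pi) -map_block_mx.
  by rewrite !rank_quotient_rk_pi (syl_trig rkP).
- move=> m n p A B; rewrite -[A]map_rank_reprK -[B]map_rank_reprK -map_mxM.
  by rewrite !rank_quotient_rk_pi (syl_mul rkP).
Qed.

(** A lift of rank 0 has entries of rank 0 by [syl_entry], and these vanish in the quotient. *)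
Lemma rank_quotient_faithful m n (A : 'M[rank_quotient]_(m, n)) :
  rank_quotient_rk (mat A) = 0 -> A = 0.
Proof.
rewrite -[A]map_rank_reprK; move: (map_mx _ A) => {}A.
rewrite rank_quotient_rk_pi => A0; apply/matrixP => i j; rewrite !mxE.
rewrite -(raddf0 rank_pi); apply/rank_piP; rewrite subr0; apply/eqP/le_anti.
by rewrite (syl_ge0 rkP) -A0 (syl_entry rkP).
Qed.

Lemma rank_quotient_regular :
  von_neumann_regular S -> von_neumann_regular rank_quotient.
Proof.
move=> regS; elim/rank_quotient_ind=> a; have [b ab] := regS a.
by exists (rank_pi b); rewrite [in LHS]ab !rmorphM.
Qed.

End RankQuotient.

(* Dividing out the kernel of the rank function shows that faithfulness may be
   dropped from the definition of [Rank]. *)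
Lemma Rank_regular (F : realType) (K : fieldType) (R S : algType K)
    (rk : Mat S -> F) (rho : {lrmorphism R -> S}) :
  von_neumann_regular S -> sylvester_rank_function rk ->
  Rank F K R (fun A : Mat R => rk (mat (map_mx rho (projT2 A)))).
Proof.
move=> regS rkP.
pose Q := RankAlgebra (rank_quotient_regular (rkP := rkP) regS)
  (rank_quotient_sylvester rkP) (@rank_quotient_faithful _ _ _ _ rkP).
pose pi : {lrmorphism S -> Q} := @rank_pi F K S rk rkP.
have repE : (fun A : Mat R => rk (mat (map_mx rho (projT2 A)))) =
    rk_rep (S := Q) (pi \o rho).
  apply/funext => A; rewrite -(rank_quotient_rk_pi rkP (map_mx rho (projT2 A))).
  by congr (rank_quotient_rk (mat _)); apply/matrixP => i j; rewrite !mxE.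
split; last by exists Q, (pi \o rho).
(* It remains that the pullback along [rho] satisfies the axioms: [map_mx] preserves identities,
   blocks and products. *)
split.
- by move=> A; exact: (syl_ge0 rkP).
- by rewrite /= map_mx1 (syl1 rkP).
- by move=> m n p q A B; rewrite /= map_block_mx !map_mx0 (syl_diag rkP).
- by move=> m n p q A B C; rewrite /= map_block_mx !map_mx0 (syl_trig rkP).
- by move=> m n p A B; rewrite /= map_mxM (syl_mul rkP).
Qed.

(** * Products of algebras *)

Section DependentProduct.
Variables (K : pzRingType) (I : pointedType) (S : I -> algType K).

(** A named copy of the dependent function type, to carry the pointwise structure. The index type is
    pointed so that the product is a nonzero ring. *)
Definition alg_prod : Type := forall i, S i.

HB.instance Definition _ := gen_eqMixin alg_prod.
HB.instance Definition _ := gen_choiceMixin alg_prod.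

Implicit Types (x y z : alg_prod) (k : K).

Lemma alg_prodP x y : (forall i, x i = y i) -> x = y.
Proof. exact: functional_extensionality_dep. Qed.

Definition alg_prod_zero : alg_prod := fun i => 0.
Definition alg_prod_opp x : alg_prod := fun i => - x i.
Definition alg_prod_add x y : alg_prod := fun i => x i + y i.
Definition alg_prod_one : alg_prod := fun i => 1.
Definition alg_prod_mul x y : alg_prod := fun i => x i * y i.
Definition alg_prod_scale k x : alg_prod := fun i => k *: x i.

Lemma alg_prod_addA : associative alg_prod_add.
Proof. by move=> x y z; apply/alg_prodP => i; exact: addrA. Qed.
Lemma alg_prod_addC : commutative alg_prod_add.
Proof. by move=> x y; apply/alg_prodP => i; exact: addrC. Qed.
Lemma alg_prod_add0 : left_id alg_prod_zero alg_prod_add.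
Proof. by move=> x; apply/alg_prodP => i; exact: add0r. Qed.
Lemma alg_prod_addN : left_inverse alg_prod_zero alg_prod_opp alg_prod_add.
Proof. by move=> x; apply/alg_prodP => i; exact: addNr. Qed.

HB.instance Definition _ := GRing.isZmodule.Build alg_prod
  alg_prod_addA alg_prod_addC alg_prod_add0 alg_prod_addN.

Lemma alg_prod_mulA : associative alg_prod_mul.
Proof. by move=> x y z; apply/alg_prodP => i; exact: mulrA. Qed.
Lemma alg_prod_mul1 : left_id alg_prod_one alg_prod_mul.
Proof. by move=> x; apply/alg_prodP => i; exact: mul1r. Qed.
Lemma alg_prod_mulr1 : right_id alg_prod_one alg_prod_mul.
Proof. by move=> x; apply/alg_prodP => i; exact: mulr1. Qed.
Lemma alg_prod_mulDl : left_distributive alg_prod_mul +%R.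
Proof. by move=> x y z; apply/alg_prodP => i; exact: mulrDl. Qed.
Lemma alg_prod_mulDr : right_distributive alg_prod_mul +%R.
Proof. by move=> x y z; apply/alg_prodP => i; exact: mulrDr. Qed.
Lemma alg_prod_one_neq0 : alg_prod_one != 0.
Proof.
by apply/eqP => /(congr1 (fun x : alg_prod => x point))/eqP; rewrite oner_eq0.
Qed.

HB.instance Definition _ := GRing.Zmodule_isNzRing.Build alg_prod
  alg_prod_mulA alg_prod_mul1 alg_prod_mulr1
  alg_prod_mulDl alg_prod_mulDr alg_prod_one_neq0.

Lemma alg_prod_scaleA k l x :
  alg_prod_scale k (alg_prod_scale l x) = alg_prod_scale (k * l) x.
Proof. by apply/alg_prodP => i; exact: scalerA. Qed.
Lemma alg_prod_scale1 : left_id 1 alg_prod_scale.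
Proof. by move=> x; apply/alg_prodP => i; exact: scale1r. Qed.
Lemma alg_prod_scaleDr : right_distributive alg_prod_scale +%R.
Proof. by move=> k x y; apply/alg_prodP => i; exact: scalerDr. Qed.
Lemma alg_prod_scaleDl x : {morph alg_prod_scale^~ x : k l / k + l}.
Proof. by move=> k l; apply/alg_prodP => i; exact: scalerDl. Qed.

HB.instance Definition _ := GRing.Zmodule_isLmodule.Build K alg_prod
  alg_prod_scaleA alg_prod_scale1 alg_prod_scaleDr alg_prod_scaleDl.

Lemma alg_prod_scaleAl k x y : k *: (x * y) = (k *: x) * y.
Proof. by apply/alg_prodP => i; exact: scalerAl. Qed.

HB.instance Definition _ :=
  GRing.Lmodule_isLalgebra.Build K alg_prod alg_prod_scaleAl.

Lemma alg_prod_scaleAr k x y : k *: (x * y) = x * (k *: y).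
Proof. by apply/alg_prodP => i; exact: scalerAr. Qed.

HB.instance Definition _ :=
  GRing.Lalgebra_isAlgebra.Build K alg_prod alg_prod_scaleAr.

Definition alg_proj i (x : alg_prod) : S i := x i.

Lemma alg_proj_zmod_morphism i : zmod_morphism (alg_proj i).
Proof. by []. Qed.
Lemma alg_proj_monoid_morphism i : monoid_morphism (alg_proj i).
Proof. by []. Qed.

HB.instance Definition _ i := GRing.isZmodMorphism.Build alg_prod (S i)
  (alg_proj i) (alg_proj_zmod_morphism i).
HB.instance Definition _ i := GRing.isMonoidMorphism.Build alg_prod (S i)
  (alg_proj i) (alg_proj_monoid_morphism i).

Variables (R : algType K) (rho : forall i, {lrmorphism R -> S i}).

Definition alg_pairing (a : R) : alg_prod := fun i => rho i a.

Lemma alg_pairing_zmod_morphism : zmod_morphism alg_pairing.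
Proof. by move=> a b; apply/alg_prodP => i; exact: rmorphB. Qed.
Lemma alg_pairing_monoid_morphism : monoid_morphism alg_pairing.
Proof.
split=> [|a b]; apply/alg_prodP => i; first exact: rmorph1.
exact: rmorphM.
Qed.
Lemma alg_pairing_scalable : scalable alg_pairing.
Proof. by move=> k a; apply/alg_prodP => i; exact: linearZ. Qed.

HB.instance Definition _ := GRing.isZmodMorphism.Build R alg_prod
  alg_pairing alg_pairing_zmod_morphism.
HB.instance Definition _ := GRing.isMonoidMorphism.Build R alg_prod
  alg_pairing alg_pairing_monoid_morphism.
HB.instance Definition _ := GRing.isScalable.Build K R alg_prod *:%R
  alg_pairing alg_pairing_scalable.

End DependentProduct.

(** Quasi-inverses are chosen in each component. *)
Lemma alg_prod_regular (K : pzRingType) (I : pointedType) (S : I -> algType K) :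
  (forall i, von_neumann_regular (S i)) -> von_neumann_regular (alg_prod S).
Proof.
move=> regS a; exists (fun i => sval (cid (regS i (a i)))).
apply/alg_prodP => i; exact: (svalP (cid (regS i (a i)))).
Qed.

(** * Means, and averages of ranks over a product *)

(* Means are only evaluated at bounded nonnegative functions, so that limits
   along ultrafilters qualify. *)
Definition bounded_ge0 (F : realType) (I : Type) (f : I -> F) : Prop :=
  exists M, forall i, 0 <= f i <= M.

(** A normalized, finitely additive, monotone average: the three fields carry over the unit,
    additivity and inequality axioms of rank functions respectively. *)
Record mean (F : realType) (I : Type) (L : (I -> F) -> F) : Prop := Mean {
  mean1 : L (fun=> 1) = 1;
  meanD : forall f g, bounded_ge0 f -> bounded_ge0 g ->
    L (fun i => f i + g i) = L f + L g;
  mean_le : forall f g, bounded_ge0 f -> bounded_ge0 g ->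
    (forall i, f i <= g i) -> L f <= L g
}.

Section MeanOfRanks.
Variables (F : realType) (K : fieldType) (I : pointedType).
Variables (S : I -> rank_algebra F K) (L : (I -> F) -> F).
Hypothesis LP : mean L.

Definition mean_rank (A : Mat (alg_prod S)) : F :=
  L (fun i => rank_of (mat (map_mx (@alg_proj K I S i) (projT2 A)))).

(** The common number of rows bounds the ranks uniformly in [i]. *)
Lemma bounded_ge0_rank_of m n (A : forall i, 'M[S i]_(m, n)) :
  bounded_ge0 (fun i => rank_of (mat (A i))).
Proof.
exists m%:R => i; have SP := rank_of_sylvester (S i).
by rewrite (syl_ge0 SP) (syl_le_row SP).
Qed.

Lemma mean_rank_sylvester : sylvester_rank_function mean_rank.
Proof.
have b0 : bounded_ge0 (fun _ : I => 0 : F) by exists 0 => i; rewrite lexx.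
(* Additivity at 0 + 0 gives this; the averaged rank is then nonnegative by monotonicity. *)
have L0 : L (fun=> 0) = 0.
  have /eqP := meanD LP b0 b0; under eq_fun do rewrite addr0.
  by rewrite -[X in X == _]addr0 (inj_eq (addrI _)) => /eqP.
split.
- move=> A; rewrite -L0; apply: mean_le => //; first exact: bounded_ge0_rank_of.
  by move=> i; exact: (syl_ge0 (rank_of_sylvester _)).
- rewrite /mean_rank/= -[RHS](mean1 LP); congr L; apply/funext => i.
  by rewrite map_mx1 (syl1 (rank_of_sylvester _)).
- move=> m n p q A B; rewrite -meanD//; [|exact: bounded_ge0_rank_of..].
  congr L; apply/funext => i.
  by rewrite /= map_block_mx !map_mx0 (syl_diag (rank_of_sylvester _)).
- move=> m n p q A B C; rewrite -meanD//; [|exact: bounded_ge0_rank_of..].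
  apply: mean_le => //.
  + have [M leM] := bounded_ge0_rank_of (fun i => map_mx (@alg_proj K I S i) A).
    have [N leN] := bounded_ge0_rank_of (fun i => map_mx (@alg_proj K I S i) B).
    exists (M + N) => i; have /andP[? ?] := leM i; have /andP[? ?] := leN i.
    by rewrite addr_ge0 ?lerD.
  + exact: bounded_ge0_rank_of.
  move=> i; rewrite /= map_block_mx !map_mx0.
  exact: (syl_trig (rank_of_sylvester _)).
- move=> m n p A B; rewrite le_min; apply/andP; split; apply: mean_le => //;
    try exact: bounded_ge0_rank_of; move=> i; rewrite /= map_mxM.
  + exact: (syl_mull (rank_of_sylvester _)).
  + exact: (syl_mulr (rank_of_sylvester _)).
Qed.

(** The [rho i] pair into one representation in the product. Its averaged rank need not be faithful,
    which [Rank_regular] allows. *)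
Lemma Rank_mean (R : algType K) (rho : forall i, {lrmorphism R -> S i}) :
  Rank F K R (fun A : Mat R => L (fun i => rk_rep (rho i) A)).
Proof.
have regS := alg_prod_regular (fun i => @rank_algebra_regular _ _ (S i)).
have := @Rank_regular F K R (alg_prod S) mean_rank (alg_pairing rho)
  regS mean_rank_sylvester.
congr (Rank _ _ _ _); apply/funext => A; congr L; apply/funext => i.
by congr (rank_of (mat _)); apply/matrixP => j k; rewrite !mxE.
Qed.

End MeanOfRanks.

(** * Weighted averages and ultrafilter limits as means *)

Lemma mean_conv (F : realType) (t : {i01 F}) :
  mean (fun f : bool -> F => t%:num * f true + (1 - t%:num) * f false).
Proof.
have t0 : 0 <= t%:num by exact: ge0.
have t1 : 0 <= 1 - t%:num by rewrite subr_ge0; exact: le1.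
split=> [|f g _ _|f g _ _ fg].
- by rewrite !mulr1 addrC subrK.
- by rewrite !mulrDr addrACA.
- by rewrite lerD ?ler_wpM2l.
Qed.

Lemma ultra_fmap (I T : Type) (U : set_system I) (f : I -> T) :
  UltraFilter U -> UltraFilter (f @ U).
Proof.
move=> UU; split=> [|G GP UG]; first exact: fmap_proper_filter.
apply/seteqP; split=> [A GA|//].
(* If the preimage of [A] were not in [U], that of the complement would be, and the proper filter
   [G] would contain both [A] and its complement. *)
have [//|UnA] := in_ultra_setVsetC (f @^-1` A) UU.
by have [x [Ax /(_ Ax)]] := filter_ex (filterI GA (UG (~` A) UnA)).
Qed.

(** The image ultrafilter contains the compact segment from 0 to [M], so it converges there. *)
Lemma ultra_cvg (F : realType) (I : Type) (U : set_system I) (f : I -> F) :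
  UltraFilter U -> bounded_ge0 f -> cvg (f @ U).
Proof.
move=> UU [M fM]; have := @segment_compact F 0 M; rewrite compact_ultra.
move=> /(_ (f @ U) (ultra_fmap f UU)) [|x [_ Ux]]; last first.
  by apply/cvg_ex; exists x.
by apply: (filterE (F := U)) => i; rewrite /= in_itv; exact: fM.
Qed.

(** All limits of bounded functions exist by [ultra_cvg], so [lim] respects sums and order. *)
Lemma mean_ultralim (F : realType) (I : Type) (U : set_system I) :
  UltraFilter U -> mean (fun f : I -> F => lim (f @ U)).
Proof.
move=> UU; split=> [|f g bf bg|f g bf bg fg].
- by apply: cvg_lim => //; exact: cvg_cst.
- apply: cvg_lim => //; apply: cvgD; exact: ultra_cvg.
have cf := ultra_cvg UU bf; have cg := ultra_cvg UU bg.
rewrite -subr_ge0 -limB//; apply: limr_ge; first exact: is_cvgB.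
by apply: nearW => i; rewrite subr_ge0.
Qed.

(* [pointwise_cvgP] requires a topology on the index type. *)
Lemma ptws_cvg (T : Type) (V : topologicalType) (U : set_system (T -> V))
    (f : T -> V) :
  Filter U -> (forall t, g t @[g --> U] --> f t) -> {ptws, U --> f}.
Proof.
(* The pointwise topology is the supremum of the topologies induced by the evaluations. Constant
   functions make each evaluation surjective, so convergence can be tested on images. *)
move=> FU Uf; apply/cvg_sup => t; apply/cvg_image => [|W /Uf UW].
  by apply/seteqP; split=> v // _; exists (cst v).
exists ((fun g : T -> V => g t) @^-1` W) => //.
by apply: image_preimage; apply/seteqP; split=> v // _; exists (cst v).
Qed.

(** * Convexity and compactness of the rank spectrum *)

Theorem proposition1p1 (F : realType) (K : finFieldType) (R : falgType K) :
  [/\ Rank F K R `<=` Syl F R,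
      convex_set (Rank F K R : set (Mat R -> F^o)) &
      compact (Rank F K R)].
Proof.
split=> [_ [] //| |].
- move=> x y t; rewrite !inE => -[_ [S [rho xE]]] [_ [T [sigma yE]]].
  (* [mean_conv] gives [true] the weight [t], so the representation behind [x] sits at [true]. *)
  pose ST b := if b then S else T.
  pose tau b : {lrmorphism R -> ST b} :=
    if b return {lrmorphism R -> ST b} then rho else sigma.
  have := Rank_mean (mean_conv t) tau.
  by rewrite xE yE; congr (Rank _ _ _ _); apply/funext.
(* It suffices that every ultrafilter containing [Rank F K R] converges to one of its points. *)
rewrite compact_ultra => U UU URank.
(* As [U] is proper, [Rank F K R] has a member; its representation is the default at every [f]
   outside. *)
have [f0 [_ [S0 [rho0 _]]]] := filter_ex URank.
have /choice[Srho SrhoE] : forall f : {ptws Mat R -> F^o},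
    exists Srho : {S : rank_algebra F K & {lrmorphism R -> S}},
      Rank F K R f -> f = rk_rep (projT2 Srho).
  move=> f; have [[_ [S [rho fE]]]|nRf] := pselect (Rank F K R f).
    by exists (existT _ S rho).
  by exists (existT _ S0 rho0).
(* The limit point is the mean along [U] of the chosen rank functions, indexed by the function space
   itself. *)
exists (fun A => lim ((fun f => rk_rep (projT2 (Srho f)) A) @ U)); split.
  exact: (Rank_mean (mean_ultralim F UU) (fun f => projT2 (Srho f))).
apply: ptws_cvg => A.
(* [U]-almost every [f] lies in [Rank F K R] and so equals its chosen rank function; the values at
   [A] then converge by [ultra_cvg]. *)
apply: (@cvg_trans _ ((fun f => rk_rep (projT2 (Srho f)) A) @ U)).
  apply: near_eq_cvg; apply: filterS URank => f Rf.
  exact: esym (congr1 (@^~ A) (SrhoE f Rf)).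
apply: ultra_cvg; exact: bounded_ge0_rank_of.
Qed.
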